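(* For every $n\in\mathbb{N}$, $$N^*(n)+1\le R(V_n,V_n)\le N^*(n)+3.$$ Let $d=\frac{1}{1-c}$, where $c$ is the unique real solution of $\log\big(c^{-c}(1-c)^{c-1}\big)=1-c$, i.e., $d\approx 1.29$. Then $R(V_n,V_n)=(d+o(1))\log n$.
   Context: $\log$ denotes the logarithm with base $2$, and $o(1)$ refers to $n\to\infty$. The expression $\log\big(c^{-c}(1-c)^{c-1}\big)$ is the binary entropy $-\big(c\log c+(1-c)\log(1-c)\big)$, considered for $0<c<1$. For posets $P$ and $Q$, an (induced) copy of $P$ in $Q$ is the image of an injective map $\phi\colon P\to Q$ such that for all $X,Y\in P$, $X\le_P Y$ if and only if $\phi(X)\le_Q\phi(Y)$. $Q_N$ denotes the Boolean lattice of dimension $N$, i.e. the poset of all subsets of an $N$-element set ordered by inclusion. A blue/red coloring of a poset assigns to each of its elements the color blue or red; a subposet is blue (red) if all its elements are blue (red). The poset Ramsey number $R(P,Q)$ is the least $N\in\mathbb{N}$ such that every blue/red coloring of the elements of $Q_N$ contains a blue induced copy of $P$ or a red induced copy of $Q$. The $n$-fork $V_n$ is the poset consisting of an antichain on $n$ elements together with one element smaller than all others. The Sperner number $\alpha(n)$ is the minimal dimension $N$ such that $Q_N$ contains an antichain of size $n$. For $n,N\in\mathbb{N}$ with $N\ge\alpha(n)$, define the integers $$\beta(N,n)=\min\Big\{\beta\in\mathbb{N}:\ \binom{N}{\beta}\ge n\Big\},\qquad N^*(n)=\max\big\{N\ge\alpha(n):\ N-\beta(N,n)<\alpha(n)\big\}.$$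 *)

(* Defs.v *)
From HB Require Import structures.
From mathcomp Require Import all_boot all_order all_algebra.
From mathcomp Require Import all_classical all_reals all_analysis.
Import Order.TTheory GRing.Theory Num.Theory.
Import numFieldNormedType.Exports.

Set Implicit Arguments.
Unset Strict Implicit.
Unset Printing Implicit Defensive.

Local Open Scope classical_set_scope.

(* Convention: the natural numbers start at 1.  This is what makes N^*(n) the
   maximum of a nonempty set for n = 1 as well (alpha(1) = 1, beta(N, 1) = 1,
   N^*(1) = 1); for n >= 2 allowing 0 would not change alpha, beta, N^* or
   R(V_n, V_n).  Minima and maxima below are therefore taken over sets of
   positive integers, and the value 0 signals that there is no minimum
   (resp. maximum). *)
Definition min_nat (A : set nat) : nat :=
  xget 0 [set m | A m /\ forall k, A k -> m <= k].

Definition max_nat (A : set nat) : nat :=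
  xget 0 [set m | A m /\ forall k, A k -> k <= m].

Definition boolean_lattice (N : nat) := {set 'I_N}.

Section BooleanLatticeOrder.
(* makes inclusion the canonical order on [{set T}] *)
Import Order.DefaultSetSubsetOrder.

HB.instance Definition _ (N : nat) :=
  Order.CTBDistrLattice.on (boolean_lattice N).
HB.instance Definition _ (N : nat) := Finite.on (boolean_lattice N).
End BooleanLatticeOrder.

Definition is_copy (dP dQ : Order.disp_t) (P : porderType dP)
    (Q : porderType dQ) (A : set Q) : Prop :=
  exists phi : P -> Q,
    [/\ injective phi,
        forall X Y : P, (X <= Y)%O <-> (phi X <= phi Y)%O
      & A = range phi].
Arguments is_copy {dP dQ} P {Q} A.

Inductive color := Blue | Red.

Definition ramsey_at (dP dQ : Order.disp_t) (P : porderType dP)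
    (Q : porderType dQ) (N : nat) : Prop :=
  forall c : boolean_lattice N -> color,
    (exists A, is_copy P A /\ forall X, A X -> c X = Blue) \/
    (exists A, is_copy Q A /\ forall X, A X -> c X = Red).

Definition poset_ramsey (dP dQ : Order.disp_t) (P : porderType dP)
    (Q : porderType dQ) : nat :=
  min_nat [set N | 0 < N /\ ramsey_at P Q N].
Arguments poset_ramsey {dP dQ} P Q.

(* [None] is the minimum, the elements [Some i] are the antichain. *)
Definition fork (n : nat) : Type := option 'I_n.

HB.instance Definition _ (n : nat) := Finite.on (fork n).

Section ForkOrder.
Variable n : nat.
Implicit Types x y z : fork n.

Definition fork_le x y : bool := (x == None) || (x == y).

Fact fork_le_refl : reflexive fork_le.
Proof. by move=> x; rewrite /fork_le eqxx orbT. Qed.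

Fact fork_le_anti : antisymmetric fork_le.
Proof.
move=> x y; rewrite /fork_le => /andP[/orP[/eqP->|/eqP->//]].
by case/orP => /eqP->.
Qed.

Fact fork_le_trans : transitive fork_le.
Proof.
by move=> y x z; rewrite /fork_le => /orP[/eqP->|/eqP->].
Qed.
End ForkOrder.

Fact fork_display : Order.disp_t. Proof. exact: Order.default_display. Qed.

HB.instance Definition _ (n : nat) :=
  Order.Le_isPOrder.Build fork_display (fork n)
    (@fork_le_refl n) (@fork_le_anti n) (@fork_le_trans n).

Definition antichain (d : Order.disp_t) (P : finPOrderType d)
    (A : {set P}) : Prop :=
  {in A &, forall X Y, (X <= Y)%O -> X = Y}.

Definition sperner (n : nat) : nat :=
  min_nat [set N | 0 < N /\
    exists A : {set boolean_lattice N}, antichain A /\ #|A| = n].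

Definition beta (N n : nat) : nat :=
  min_nat [set b | 0 < b /\ n <= 'C(N, b)].

(* The subtraction never truncates: beta N n <= N when sperner n <= N. *)
Definition Nstar (n : nat) : nat :=
  max_nat [set N | sperner n <= N /\ N - beta N n < sperner n].

Definition log2 (R : realType) (x : R) : R := (ln x / ln 2)%R.

(* Main.v *)
(* Lower bound: in Q_N with N = N^*(n), color a set blue iff it has fewer than
   beta(N, n) elements.  By the LYM inequality the blue part has no antichain of
   size n >= 2, and the red sets above a red set form a Boolean lattice of
   dimension at most N - beta(N, n) < alpha(n).
   Upper bound: in Q_N with N = N^*(n) + 3, say the empty set is blue.  If the
   layer beta(N, n) contains no red set, it gives a blue fork; otherwise a red
   set X there has a Boolean lattice of dimension at least alpha(n) + 2 above it,
   hence an antichain of size 2n, half of which is blue (a fork over the empty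
   set) or red (a fork over X).
   Asymptotics: with H the entropy and H(c) = (1 - c) ln 2, the binomial
   distribution of parameter c gives ln C(N, b) <= N H(c) for b <= c N, and
   ln C(N, b) >= N H(c) - O(log N) at its mode b.  Hence, exactly,
   log n <= (1 - c) (N^*(n) + 1), and conversely
   (1 - c) N^*(n) <= log n + O(log N^*(n)). *)
Require Import Defs.
From mathcomp Require Import all_boot all_order all_algebra.
From mathcomp Require Import all_classical all_reals all_analysis.
From mathcomp Require Import ring lra zify.
Import Order.TTheory GRing.Theory Num.Theory.
Import numFieldNormedType.Exports.

Set Implicit Arguments.
Unset Strict Implicit.
Unset Printing Implicit Defensive.

Local Open Scope classical_set_scope.
Local Open Scope ring_scope.

(** * Minima and maxima of sets of natural numbers *)

Lemma min_natP (A : set nat) : A !=set0 ->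
  A (min_nat A) /\ forall k, A k -> (min_nat A <= k)%N.
Proof.
move=> [a Aa]; apply: (@xgetPex _ 0%N [set m | A m /\ forall k, A k -> (m <= k)%N]).
have ex : exists m, `[< A m >] by exists a; apply/asboolP.
case: (ex_minnP ex) => m /asboolP Am mmin; exists m; split => // k Ak.
by apply: mmin; apply/asboolP.
Qed.

Lemma max_natP (A : set nat) (b : nat) :
  A !=set0 -> (forall k, A k -> (k <= b)%N) ->
  A (max_nat A) /\ forall k, A k -> (k <= max_nat A)%N.
Proof.
move=> [a Aa] Ab; apply: (@xgetPex _ 0%N [set m | A m /\ forall k, A k -> (k <= m)%N]).
have ex : exists m, `[< A m >] by exists a; apply/asboolP.
have ub m : `[< A m >] -> (m <= b)%N by move=> /asboolP /Ab.
case: (ex_maxnP ex ub) => m /asboolP Am mmax; exists m; split => // k Ak.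
by apply: mmax; apply/asboolP.
Qed.

(** * Antichains of sets and the LYM inequality *)

Definition sub_antichain (T : finType) (F : {set {set T}}) : Prop :=
  {in F &, forall X Y : {set T}, X \subset Y -> X = Y}.

(* Lubell-Yamamoto-Meshalkin inequality.  Induction on [S]: average the
   inequalities for the members of [F] avoiding [x] over all [x] in [S]. *)
Lemma LYM (T : finType) (S : {set T}) (F : {set {set T}}) :
  sub_antichain F -> {in F, forall X : {set T}, X \subset S} ->
  \sum_(X in F) ('C(#|S|, #|X|)%:R : rat)^-1 <= 1.
Proof.
elim: {S}_.+1 {-2}S F (ltnSn #|S|) => // m IH S F Sm Fanti FS.
have [SF|SF] := boolP (S \in F).
  have -> : F = [set S]%SET.
    apply/setP => X; rewrite inE; apply/idP/eqP => [XF|->//].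
    by apply: Fanti => //; exact: FS.
  by rewrite big_set1 binn invr1.
have Fproper X : X \in F -> X \proper S.
  move=> XF; rewrite finset.properEneq FS // andbT.
  by apply: contraNneq SF => <-.
have [S0|S_gt0] := posnP #|S|.
  rewrite big1 // => X /Fproper /proper_card; by rewrite S0.
pose G x := [set X in F | x \notin X]%SET.
have IHx x : x \in S ->
    \sum_(X in F | x \notin X) ('C(#|S|.-1, #|X|)%:R : rat)^-1 <= 1.
  move=> xS; have cS : #|(S :\ x)%SET| = #|S|.-1 by rewrite (cardsD1 x S) xS.
  have := IH (S :\ x)%SET (G x); rewrite cS; under eq_bigl do rewrite inE.
  apply.
  - by lia.
  - by move=> X Y; rewrite !inE => /andP[XF _] /andP[YF _]; exact: Fanti.
  - by move=> X; rewrite inE => /andP[XF xX]; rewrite subsetD1 FS.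
(* Each [X] in [F] is avoided by [#|S| - #|X|] points of [S], and
   [(s - k) / 'C(s - 1, k) = s / 'C(s, k)]. *)
have swap : \sum_(x in S) \sum_(X in F | x \notin X)
    ('C(#|S|.-1, #|X|)%:R : rat)^-1
    = #|S|%:R * \sum_(X in F) ('C(#|S|, #|X|)%:R : rat)^-1.
  rewrite (exchange_big_dep (mem F)) /=; last by move=> x X _ /andP[].
  rewrite mulr_sumr; apply: eq_bigr => X XF.
  rewrite sumr_const.
  have -> : #|[pred x | x \in S & (X \in F) && (x \notin X)]| = (#|S| - #|X|)%N.
    rewrite -(cardsDS (FS _ XF)); apply: eq_card => x.
    by rewrite !inE XF andbC.
  have XS := proper_card (Fproper _ XF).
  have := mul_bin_down #|S| #|X| => /(congr1 (fun k => k%:R : rat)).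
  rewrite !natrM => E.
  have n1 : ('C(#|S|, #|X|)%:R : rat) != 0 by rewrite pnatr_eq0 -lt0n bin_gt0 ltnW.
  have n2 : ('C(#|S|.-1, #|X|)%:R : rat) != 0.
    by rewrite pnatr_eq0 -lt0n bin_gt0; lia.
  by rewrite -[LHS]mulr_natl; apply/eqP; rewrite eqr_div // E.
rewrite -(ler_pM2l (_ : 0 < #|S|%:R)) ?ltr0n // -swap mulr1.
apply: le_trans (ler_sum _ IHx) _.
by rewrite sumr_const lexx.
Qed.

Lemma leq_bin_half_step (N k : nat) : (k.*2 < N)%N -> ('C(N, k) <= 'C(N, k.+1))%N.
Proof.
move=> kN; rewrite -(@leq_pmul2l k.+1) // mul_bin_left leq_mul2r.
by apply/orP; right; lia.
Qed.

Lemma leq_bin_half (N j k : nat) : (k <= j)%N -> (j.*2 <= N)%N -> ('C(N, k) <= 'C(N, j))%N.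
Proof.
move=> kj; elim: j kj => [|j IH]; first by rewrite leqn0 => /eqP->.
rewrite leq_eqVlt => /predU1P[->//|kj] jN.
by apply: leq_trans (leq_bin_half_step _); [apply: IH|]; lia.
Qed.

Lemma bin_le_central (N k : nat) : ('C(N, k) <= 'C(N, N./2))%N.
Proof.
have [kN|Nk] := leqP k N; last by rewrite bin_small.
have [kh|hk] := leqP k N./2; first by apply: leq_bin_half; lia.
by rewrite -bin_sub //; apply: leq_bin_half; lia.
Qed.

(** Every term of the LYM sum is at least [1 / M]. *)
Lemma sub_antichain_card (T : finType) (S : {set T}) (F : {set {set T}}) (M : nat) :
  sub_antichain F -> {in F, forall X : {set T}, X \subset S} ->
  {in F, forall X : {set T}, 'C(#|S|, #|X|) <= M}%N -> (#|F| <= M)%N.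
Proof.
move=> Fanti FS FM.
have [->|[X0 X0F]] := set_0Vmem F; first by rewrite cards0.
have bpos X : X \in F -> (0 < 'C(#|S|, #|X|))%N.
  by move=> /FS /subset_leq_card; rewrite bin_gt0.
have M0 : (0 < M)%N by apply: leq_trans (bpos _ X0F) (FM _ X0F).
rewrite -(ler_nat rat) -[leRHS]mul1r -ler_pdivrMr ?ltr0n //.
apply: le_trans (LYM Fanti FS); rewrite -sum1_card natr_sum mulr_suml.
apply: ler_sum => X XF; rewrite mul1r lef_pV2 ?posrE ?ltr0n ?bpos //.
by rewrite ler_nat FM.
Qed.

(** * Sperner's theorem; alpha, beta and N^* through binomial coefficients *)

(** Sperner's theorem: the central coefficient bounds antichains by LYM, and the middle layer
    attains it. *)
Lemma sperner_antichainP (n N : nat) : (0 < N)%N ->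
  (exists A : {set boolean_lattice N}, antichain A /\ #|A| = n) <->
  (n <= 'C(N, N./2))%N.
Proof.
move=> N0; split=> [[A [Aanti <-]]|nC].
  apply: (@sub_antichain_card 'I_N [set: 'I_N]%SET (A : {set {set 'I_N}})).
  - exact: Aanti.
  - by move=> X _; exact: finset.subsetT.
  - by move=> X _; rewrite cardsT card_ord bin_le_central.
pose L := [set X : {set 'I_N} | #|X| == N./2]%SET.
have cL : #|L| = 'C(N, N./2) by rewrite card_draws card_ord.
have := nC; rewrite -cL => /card_geqP[s [us ss sL]].
exists [set x in s]%SET; split; last by rewrite cardsE (card_uniqP us) ss.
move=> X Y; rewrite !inE => /sL; rewrite inE => /eqP cX /sL; rewrite inE => /eqP cY.
move=> XY; have XY' : (X : {set 'I_N}) \subset (Y : {set 'I_N}) := XY.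
by apply/eqP; rewrite eqEcard XY' cX cY /=.
Qed.

Lemma leq_bin_central (n : nat) : (0 < n)%N -> (n <= 'C(n, n./2))%N.
Proof. by move=> n0; rewrite -{1}(bin1 n) bin_le_central. Qed.

Lemma spernerP (n : nat) : (0 < n)%N ->
  [/\ (0 < sperner n)%N, (n <= 'C(sperner n, (sperner n)./2))%N
    & forall N, (0 < N)%N -> (n <= 'C(N, N./2))%N -> (sperner n <= N)%N].
Proof.
move=> n0; rewrite /sperner; set A := (X in min_nat X).
have [|[s0 /(sperner_antichainP _ s0) sC] smin] := @min_natP A.
  by exists n; split=> //; apply/sperner_antichainP => //; exact: leq_bin_central.
split => // N N0 /(sperner_antichainP _ N0) NA; exact: smin.
Qed.

Lemma betaP (N n : nat) : (0 < n)%N -> (sperner n <= N)%N ->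
  [/\ (0 < beta N n)%N, (n <= 'C(N, beta N n))%N
    & forall b, (0 < b)%N -> (n <= 'C(N, b))%N -> (beta N n <= b)%N].
Proof.
move=> n0 sN; have [s0 sC _] := spernerP n0.
rewrite /beta; set A := (X in min_nat X).
have [|[b0 bC] bmin] := @min_natP A; last first.
  by split => // b b_gt0 nb; exact: bmin.
have [N1|N1] := leqP 2 N.
  exists N./2; split; first lia.
  apply: leq_trans sC _; apply: leq_trans (bin_le_central _ _).
  by apply: leq_bin2l.
(* For [N = 1] the middle layer has index 0, which [beta] excludes; layer 1 is as large. *)
exists 1%N; split=> //; move: sC.
have -> : N = 1%N by lia.
by have -> : sperner n = 1%N by lia.
Qed.

Lemma NstarP (n : nat) : (0 < n)%N ->
  [/\ (sperner n <= Nstar n)%N, (Nstar n - beta (Nstar n) n < sperner n)%N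
    & forall N, (sperner n <= N)%N -> (N - beta N n < sperner n)%N -> (N <= Nstar n)%N].
Proof.
move=> n0; have [s0 sC _] := spernerP n0.
rewrite /Nstar; set A := (X in max_nat X).
(* Beyond [sperner n + n] layer 1 already has [n] sets, so [beta] is 1 and the defining inequality
   of [Nstar] fails. *)
have [|k [sk kb]|[? ?] h] := @max_natP A (sperner n + n); last by split=> // N *; exact: h.
  exists (sperner n); split=> //.
  by have [b0 _ _] := betaP n0 (leqnn _); lia.
have [//|kn] := leqP k (sperner n + n).
have [_ _ bmin] := betaP n0 sk.
by have := bmin 1%N isT; rewrite bin1; lia.
Qed.

(** * Forks in Boolean lattices and monotonicity of the Ramsey property *)

(** Reduces copies of a fork to a bottom set with a family above it; any [n] members of a larger
    family serve as the tips. *)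
Lemma fork_copyP (N n : nat) (P : boolean_lattice N -> Prop) :
  (exists A, is_copy (fork n) A /\ forall X, A X -> P X) <->
  exists (X : {set 'I_N}) (F : {set {set 'I_N}}),
    [/\ P X, sub_antichain F, (n <= #|F|)%N
      & forall Y, Y \in F -> P Y /\ X \proper Y].
Proof.
split=> [[A [[phi [phi_inj phi_le ->]] AP]]|[X [F [PX Fanti nF FP]]]].
  pose g (i : 'I_n) : {set 'I_N} := phi (Some i).
  exists (phi None), (g @: [set: 'I_n])%SET; split.
  - by apply: AP; exists None.
  - move=> _ _ /imsetP[i _ ->] /imsetP[j _ ->] gij.
    have /phi_le : (phi (Some i) <= phi (Some j))%O by exact: gij.
    by move=> /orP[|/eqP[->]].
  - rewrite card_imset ?cardsT ?card_ord // => i j gij.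
    by have [] := phi_inj (Some i) (Some j) gij.
  - move=> _ /imsetP[i _ ->]; split; first by apply: AP; exists (Some i).
    rewrite finset.properEneq; apply/andP; split.
      by apply/negP => /eqP /phi_inj.
    by have /phi_le : (None <= Some i :> fork n)%O by [].
have /card_geqP[s [us ss sF]] := nF.
have nthF (i : 'I_n) : nth finset.set0 s i \in F by rewrite sF // mem_nth // ss.
pose phi (x : fork n) : boolean_lattice N :=
  if x is Some i then nth finset.set0 s i else X.
have phi_le x y : (x <= y)%O <-> (phi x <= phi y)%O.
  case: x y => [i|] [j|]; split => //.
  - by move=> /orP[//|/eqP[->]].
  - move=> /(Fanti _ _ (nthF i) (nthF j)) /eqP.
    by rewrite nth_uniq ?ss // => /eqP /ord_inj ->.
  - have [_ /andP[_ /negP XY]] := FP _ (nthF i).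
    by move=> YX; case: XY; exact: YX.
  - by have [_ /proper_sub] := FP _ (nthF j).
exists (range phi); split; last first.
  by move=> _ [[i|] _ <-] //; have [] := FP _ (nthF i).
exists phi; split => // x y xy; apply/eqP; rewrite eq_le.
by apply/andP; split; apply/phi_le; rewrite xy.
Qed.

(** A coloring of the larger lattice is pulled back along the embedding induced by [widen_ord]. This
    extends failure at one dimension to all smaller ones. *)
Lemma ramsey_at_leq (dP dQ : Order.disp_t) (P : porderType dP)
    (Q : porderType dQ) (M N : nat) :
  (M <= N)%N -> ramsey_at P Q M -> ramsey_at P Q N.
Proof.
move=> MN ram c.
pose f (X : boolean_lattice M) : boolean_lattice N := (widen_ord MN @: X)%SET.
have winj : injective (widen_ord MN).
  by move=> i j /(congr1 val) /= ij; exact: val_inj.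
have f_le X Y : (f X <= f Y)%O = (X <= Y)%O.
  apply/idP/idP => [fXY|]; last exact: imsetS.
  apply/fintype.subsetP => i iX; have /fintype.subsetP fXY' := fXY.
  by rewrite -(mem_imset _ _ winj); apply: fXY'; rewrite mem_imset.
have lift dS (S : porderType dS) (A : set (boolean_lattice M)) col :
    is_copy S A -> (forall X, A X -> c (f X) = col) ->
    exists B, is_copy S B /\ forall X, B X -> c X = col.
  move=> [phi [phi_inj phi_le ->]] Acol; exists (range (f \o phi)); split.
    exists (f \o phi); split=> // [|X Y].
      by apply: inj_comp => // X Y; exact: imset_inj.
    by rewrite /= f_le.
  by move=> _ [x _ <-]; apply: Acol; exists x.
have [[A [Ac Acol]]|[A [Ac Acol]]] := ram (c \o f).
  by left; exact: (lift _ _ A).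
by right; exact: (lift _ _ A).
Qed.

(** * Bounds on the Ramsey number of forks *)

Lemma leq_beta (M N n : nat) : (0 < n)%N -> (sperner n <= M)%N ->
  (M <= N)%N -> (beta N n <= beta M n)%N.
Proof.
move=> n0 sM MN; have [b0 nC _] := betaP n0 sM.
have [_ _ bmin] := betaP n0 (leq_trans sM MN).
by apply: bmin => //; apply: leq_trans nC _; exact: leq_bin2l.
Qed.

(** Places the layers below [beta N n] in the half where binomial coefficients increase. The
    predecessor also covers [N = 1], where [beta] is 1. *)
Lemma double_beta (N n : nat) : (0 < n)%N -> (sperner n <= N)%N ->
  ((beta N n).-1.*2 <= N)%N.
Proof.
move=> n0 sN; have [b0 nC bmin] := betaP n0 sN.
have [s0 sC _] := spernerP n0.
have bN : (beta N n <= N)%N by rewrite -bin_gt0; exact: leq_trans nC.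
have [N2|N1] := leqP 2 N; last lia.
suff : (beta N n <= N./2)%N by lia.
apply: bmin; first lia.
by apply: leq_trans sC _; apply: leq_trans (bin_le_central _ _); exact: leq_bin2l.
Qed.

Lemma not_ramsey_at_Nstar (n : nat) : (0 < n)%N ->
  ~ ramsey_at (fork n) (fork n) (Nstar n).
Proof.
move=> n0; have [sN bN _] := NstarP n0; set N := Nstar n in sN bN *.
have [b0 nC bmin] := betaP n0 sN; have [s0 _ smin] := spernerP n0.
pose c (X : boolean_lattice N) := if (#|X| < beta N n)%N then Blue else Red.
move=> /(_ c)[] /fork_copyP[X [F [cX Fanti nF FP]]].
  have Fb Y : Y \in F -> (0 < #|Y| < beta N n)%N.
    move=> /FP[+ /proper_card]; rewrite /c; case: ltnP => // _ _; lia.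
  have [Y YF] : exists Y, Y \in F by apply/card_gt0P; lia.
  (* This contradicts the minimality of [beta]: a tip [Y] has [0 < #|Y| < beta N n], so the index
     [(beta N n).-1] is positive. *)
  have nC1 : (n <= 'C(N, (beta N n).-1))%N.
    apply: leq_trans nF _; apply: (sub_antichain_card (S := [set: 'I_N]%SET)) => //.
    move=> Z /Fb Zb; rewrite cardsT card_ord; apply: leq_bin_half; first lia.
    exact: double_beta.
  by have := Fb _ YF; have := bmin (beta N n).-1; lia.
have Xb : (beta N n <= #|X|)%N by move: cX; rewrite /c; case: ltnP.
have cT : #|(~: X)%SET| = (N - #|X|)%N by rewrite cardsCs finset.setCK card_ord.
(* Removing [X] maps the red tips injectively to an antichain of subsets of [~: X], where Sperner's
   theorem applies. *)
have XF Y : Y \in F -> Y = (X :|: (Y :\: X))%SET.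
  move=> /FP[_ /proper_sub /finset.setIidPr XY].
  by rewrite -{1}(finset.setID Y X) XY.
have Dinj : {in F &, injective (fun Y => Y :\: X)%SET}.
  by move=> Y Z /XF YE /XF ZE /= YZ; rewrite YE YZ -ZE.
have [Y YF] : exists Y, Y \in F by apply/card_gt0P; lia.
(* A tip strictly above [X] makes [N - #|X|] positive, as [smin] requires. *)
have [_ /proper_card XY] := FP _ YF.
have YN : (#|Y| <= N)%N by have := max_card Y; rewrite card_ord.
have : (n <= 'C(N - #|X|, (N - #|X|)./2))%N.
  apply: leq_trans nF _; rewrite -(card_in_imset Dinj).
  apply: (sub_antichain_card (S := (~: X)%SET)).
  - move=> _ _ /imsetP[Y1 Y1F ->] /imsetP[Y2 Y2F ->] Y12.
    rewrite (Fanti Y1 Y2) // (XF _ Y1F) (XF _ Y2F).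
    exact: finset.setUS.
  - by move=> _ /imsetP[Z _ ->]; rewrite finset.setDE finset.subsetIr.
  - by move=> Z _; rewrite cT bin_le_central.
by move=> /smin; lia.
Qed.

(** By Pascal's rule ['C(a + 2, k + 1)] contains ['C(a, k)] and ['C(a + 1, k) >= 'C(a, k)]. So two
    more dimensions double the size of an antichain. *)
Lemma double_bin_central (a m : nat) : (a.+2 <= m)%N ->
  (('C(a, a./2)).*2 <= 'C(m, m./2))%N.
Proof.
move=> am; apply: (@leq_trans 'C(a.+2, a./2.+1)).
  by rewrite !binS; have := leq_bin2l a./2 (leqnSn a); lia.
by apply: leq_trans (bin_le_central _ _); exact: leq_bin2l.
Qed.

Lemma ramsey_at_Nstar3 (n : nat) : (0 < n)%N ->
  ramsey_at (fork n) (fork n) (Nstar n + 3).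
Proof.
move=> n0; have [sN bN Nmax] := NstarP n0; have [s0 sC smin] := spernerP n0.
set N := (Nstar n + 3)%N; move=> c.
have sN' : (sperner n <= N)%N by lia.
have [b0 nC bmin] := betaP n0 sN'.
(* Dimension [Nstar n + 1] violates the condition defining [Nstar]; two further dimensions add 2
   since [beta] does not increase. *)
have room : ((sperner n).+2 <= N - beta N n)%N.
  have sN1 : (sperner n <= (Nstar n).+1)%N by lia.
  have : (sperner n <= (Nstar n).+1 - beta (Nstar n).+1 n)%N.
    by rewrite leqNgt; apply/negP => /(Nmax _ sN1); rewrite ltnn.
  have := @leq_beta (Nstar n).+1 N n n0 sN1; lia.
(* By symmetry, [k] is the color of the empty set and [k'] the other one. *)
suff two k k' : (forall X, c X = k \/ c X = k') -> c finset.set0 = k ->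
    (exists A, is_copy (fork n) A /\ forall X, A X -> c X = k) \/
    (exists A, is_copy (fork n) A /\ forall X, A X -> c X = k').
  case c0 : (c finset.set0).
    by apply: two c0 => X; case: (c X); auto.
  by apply/or_comm; apply: two c0 => X; case: (c X); auto.
move=> ckk' c0.
have level_anti (F : {set {set 'I_N}}) h :
    {in F, forall X : {set 'I_N}, #|X| = h} -> sub_antichain F.
  move=> Fh X Y /Fh Xh /Fh Yh XY; apply/eqP.
  by rewrite eqEcard XY Xh Yh leqnn.
have [blue|/existsNP[X /not_implyP[Xb cX]]] :=
    pselect (forall X : {set 'I_N}, #|X| = beta N n -> c X = k).
  left; apply/fork_copyP; exists finset.set0, [set X : {set 'I_N} | #|X| == beta N n]%SET.
  split=> //.
  - by apply: (level_anti _ (beta N n)) => X; rewrite inE => /eqP.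
  - by rewrite card_draws card_ord.
  - move=> Y; rewrite inE => /eqP Yb; split; first exact: blue.
    by rewrite finset.proper0 -card_gt0 Yb.
have cX' : c X = k' by case: (ckk' X).
have cT : #|(~: X)%SET| = (N - beta N n)%N by rewrite cardsCs finset.setCK card_ord Xb.
set m := (N - beta N n)%N in room cT.
(* The middle layer of the lattice of subsets of [~: X]; its translate [G] by [X] lies in one layer
   and has at least [2n] members to split by color. *)
pose D := [set Z : {set 'I_N} | Z \subset ~: X & #|Z| == m./2]%SET.
have cD : #|D| = 'C(m, m./2) by rewrite cards_draws cT.
have cXZ Z : Z \in D -> #|(X :|: Z)%SET| = (beta N n + m./2)%N.
  rewrite inE => /andP[ZX /eqP Zm]; rewrite cardsU Xb Zm.
  suff -> : (X :&: Z)%SET = finset.set0 by rewrite cards0 subn0.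
  by rewrite finset.setIC; apply/eqP; rewrite finset.setI_eq0 finset.disjoints_subset.
have Uinj : {in D &, injective (fun Z => X :|: Z)%SET}.
  have UD Z : Z \in D -> ((X :|: Z) :\: X)%SET = Z.
    rewrite inE => /andP[ZX _]; rewrite finset.setDUl finset.setDv finset.set0U.
    by apply/finset.setDidPl; rewrite finset.disjoints_subset.
  by move=> Y Z /UD YE /UD ZE /= YZ; rewrite -YE YZ ZE.
pose G := [set (X :|: Z)%SET | Z in D]%SET.
have cG : (n.*2 <= #|G|)%N.
  by rewrite card_in_imset // cD; apply: leq_trans (double_bin_central room); lia.
have Gh : {in G, forall Y : {set 'I_N}, #|Y| = (beta N n + m./2)%N}.
  by move=> _ /imsetP[Z ZD ->]; exact: cXZ.
pose K := [set Y : {set 'I_N} | `[< c Y = k >]]%SET.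
have [nK|Kn] := leqP n #|(G :&: K)%SET|.
  left; apply/fork_copyP; exists finset.set0, (G :&: K)%SET; split=> //.
    by apply: (level_anti _ (beta N n + m./2)%N) => Y; rewrite inE => /andP[/Gh].
  move=> Y; rewrite 2!inE => /andP[/Gh Yh /asboolP cY]; split => //.
  by rewrite finset.proper0 -card_gt0 Yh; lia.
right; apply/fork_copyP; exists X, (G :\: K)%SET; split=> //.
- by apply: (level_anti _ (beta N n + m./2)%N) => Y; rewrite inE => /andP[_ /Gh].
- move: cG Kn; rewrite -(cardsID K G).
  by set x := #|(_ :&: _)%SET|; set y := #|(_ :\: _)%SET|; lia.
- move=> Y; rewrite 2!inE => /andP[/asboolPn cY YG]; split; first by case: (ckk' Y).
  move: (Gh _ YG); have /imsetP[Z ZD ->] := YG => XZh.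
  (* The inclusion is strict because [room] gives [m >= 2], hence [m./2 > 0]. *)
  by rewrite finset.properEcard finset.subsetUl XZh Xb; lia.
Qed.

Lemma poset_ramsey_fork_bounds (n : nat) : (0 < n)%N ->
  (Nstar n + 1 <= poset_ramsey (fork n) (fork n) <= Nstar n + 3)%N.
Proof.
move=> n0; rewrite /poset_ramsey; set A := (X in min_nat X).
have A3 : A (Nstar n + 3)%N by split; [lia|exact: ramsey_at_Nstar3].
have [|[_ ram] Rmin] := @min_natP A; first by exists (Nstar n + 3)%N.
rewrite Rmin // andbT addn1 ltnNge; apply/negP => RN.
by apply: (@not_ramsey_at_Nstar n n0); exact: ramsey_at_leq ram.
Qed.

(** * Binomial weights and entropy bounds for binomial coefficients *)

(** Point masses of the binomial distribution, written as the summands of [exprDn] for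
    [(1 - x) + x]. *)
Definition binom_weight (R : realType) (N : nat) (x : R) (i : nat) : R :=
  (1 - x) ^+ (N - i) * x ^+ i *+ 'C(N, i).

Lemma binom_weight_sum (R : realType) (N : nat) (x : R) :
  \sum_(i < N.+1) binom_weight N x i = 1.
Proof. by rewrite -exprDn subrK expr1n. Qed.

Lemma binom_weight_ge0 (R : realType) (N : nat) (x : R) (i : nat) :
  0 <= x <= 1 -> 0 <= binom_weight N x i.
Proof.
by move=> /andP[x0 x1]; rewrite mulrn_wge0 // mulr_ge0 // exprn_ge0 // subr_ge0.
Qed.

Lemma binom_weight_le1 (R : realType) (N : nat) (x : R) (i : nat) :
  0 <= x <= 1 -> (i <= N)%N -> binom_weight N x i <= 1.
Proof.
move=> x01; rewrite -ltnS => iN; rewrite -(binom_weight_sum N x).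
rewrite (bigD1 (Ordinal iN)) //= lerDl sumr_ge0 // => j _.
exact: binom_weight_ge0.
Qed.

Lemma binom_weightS (R : realType) (N : nat) (x : R) (i : nat) : (i < N)%N ->
  binom_weight N x i.+1 * (i.+1%:R * (1 - x))
  = binom_weight N x i * ((N%:R - i%:R) * x).
Proof.
move=> iN; have := mul_bin_left N i => /(congr1 (fun k => k%:R : R)).
rewrite !natrM natrB 1?ltnW // => E.
rewrite /binom_weight -(subnSK iN) !exprS.
rewrite -[X in X * _ = _]mulr_natr -[X in _ = X * _]mulr_natr.
transitivity ((1 - x) * (1 - x) ^+ (N - i.+1) * x * x ^+ i * (i.+1%:R * 'C(N, i.+1)%:R)).
  by ring.
by rewrite E; ring.
Qed.

(* The weights increase up to the mode [floor ((N + 1) x)] and decrease after. *)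
Lemma binom_weight_mode (R : realType) (N : nat) (x : R) : 0 < x < 1 ->
  exists b : nat, [/\ (b <= N)%N, b%:R <= N.+1%:R * x < b.+1%:R
    & 1 <= N.+1%:R * binom_weight N x b].
Proof.
move=> /andP[x0 x1]; set y := N.+1%:R * x.
have y0 : 0 <= y by rewrite mulr_ge0 // ltW.
have /andP[by1 by2] := truncn_itv y0; set b := Num.trunc y in by1 by2.
have yN : y < N.+1%:R by rewrite /y -[ltRHS]mulr1 ltr_pM2l.
have bN : (b <= N)%N by rewrite -ltnS -(ltr_nat R); exact: le_lt_trans yN.
have x01 : 0 <= x <= 1 by rewrite !ltW.
have x1' : 0 < 1 - x by lra.
exists b; split => //; first by rewrite by1 by2.
have pos i := binom_weight_ge0 N i x01.
have up j i : (i <= j <= b)%N -> binom_weight N x i <= binom_weight N x j.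
  elim: j => [|j IH] /andP[]; first by rewrite leqn0 => /eqP->.
  rewrite leq_eqVlt => /predU1P[->//|ij] jb.
  apply: le_trans (IH _) _; first by rewrite -ltnS ij ltnW.
  have jN : (j < N)%N by exact: leq_trans bN.
  have jy : j.+1%:R <= y by apply: le_trans by1; rewrite ler_nat.
  have w0 : 0 < j.+1%:R * (1 - x) by rewrite mulr_gt0.
  rewrite -(ler_pM2r w0) binom_weightS // ler_wpM2l //.
  (* [(j + 1) (1 - x) <= (N - j) x] is equivalent to [j + 1 <= (N + 1) x]. *)
  by move: jy; rewrite /y -!natr1; lra.
have down i : (b <= i <= N)%N -> binom_weight N x i <= binom_weight N x b.
  elim: i => [|i IH] /andP[]; first by rewrite leqn0 => /eqP->.
  rewrite leq_eqVlt => /predU1P[->//|bi] iN.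
  apply: le_trans (IH _); last by rewrite -ltnS bi ltnW.
  have iy : y <= i.+1%:R by apply: le_trans (ltW by2) _; rewrite ler_nat.
  have w0 : 0 < i.+1%:R * (1 - x) by rewrite mulr_gt0.
  rewrite -(ler_pM2r w0) binom_weightS // ler_wpM2l //.
  by move: iy; rewrite /y -!natr1; lra.
(* The [N + 1] weights sum to 1, so the largest is at least their average. *)
rewrite -{1}(binom_weight_sum N x) mulr_natl -[in leRHS](card_ord N.+1) -sumr_const.
apply: ler_sum => i _; have [ib|bi] := leqP i b; first by apply: up; rewrite ib /=.
by apply: down; rewrite ltnW //= -ltnS.
Qed.

(* In natural logarithms: the equation defining [c] in the theorem reads
   [entropy c = (1 - c) * ln 2]. *)
Definition entropy (R : realType) (x : R) : R := - (x * ln x) - (1 - x) * ln (1 - x).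

Lemma ln_binom_weight (R : realType) (N : nat) (x : R) (i : nat) :
  0 < x < 1 -> (i <= N)%N ->
  ln (binom_weight N x i)
  = (N%:R - i%:R) * ln (1 - x) + i%:R * ln x + ln ('C(N, i)%:R : R).
Proof.
move=> /andP[x0 x1] iN; have x1' : 0 < 1 - x by rewrite subr_gt0.
have C0 : 0 < 'C(N, i)%:R :> R by rewrite ltr0n bin_gt0.
rewrite /binom_weight -[X in ln X]mulr_natr.
rewrite !lnM ?posrE ?mulr_gt0 ?exprn_gt0 // !lnXn //.
by rewrite -[_ *+ (N - i)]mulr_natl natrB // -[ln x *+ i]mulr_natl.
Qed.

(** A weight is at most 1, so [ln 'C(N, b)] is at most [N * entropy x - (N x - b) (ln (1 - x) - ln
    x)]; both factors of the correction are nonnegative. *)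
Lemma ln_bin_le (R : realType) (N b : nat) (x : R) :
  0 < x <= 1 / 2 -> b%:R <= x * N%:R ->
  ln ('C(N, b)%:R : R) <= N%:R * entropy x.
Proof.
move=> /andP[x0 x2] bx.
have N0 : 0 <= N%:R :> R by [].
have bN : (b <= N)%N by rewrite -(ler_nat R); nra.
have x01 : 0 < x < 1 by apply/andP; split; lra.
have := ln_binom_weight x01 bN.
have : ln (binom_weight N x b) <= 0.
  by rewrite ln_le0 // binom_weight_le1 //; apply/andP; split; lra.
have : 0 <= ln (1 - x) - ln x.
  by rewrite subr_ge0 ler_ln ?posrE; lra.
rewrite /entropy; nra.
Qed.

(** The same identity at the mode: the weight is at least [1 / (N + 1)], and [N x - b <= 1] bounds
    the correction. *)
Lemma ln_bin_ge (R : realType) (N : nat) (x : R) : 0 < x <= 1 / 2 ->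
  exists b : nat, [/\ (b <= N)%N, b%:R <= N.+1%:R * x
    & N%:R * entropy x - (ln (1 - x) - ln x) - ln N.+1%:R
      <= ln ('C(N, b)%:R : R)].
Proof.
move=> /andP[x0 x2]; have x01 : 0 < x < 1 by apply/andP; split; lra.
have [b [bN /andP[b1 b2] mode]] := binom_weight_mode N x01.
exists b; split => //.
have w0 : 0 < binom_weight N x b.
  by rewrite -(pmulr_rgt0 _ (ltr0Sn R N)); apply: lt_le_trans mode.
have := ln_binom_weight x01 bN.
have : 0 <= ln N.+1%:R + ln (binom_weight N x b).
  by rewrite -lnM ?posrE // ln_ge0.
have : 0 <= ln (1 - x) - ln x.
  by rewrite subr_ge0 ler_ln ?posrE; lra.
have : N%:R * x - 1 <= b%:R by move: b2; rewrite -!natr1; nra.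
rewrite /entropy; nra.
Qed.

(** * Logarithmic estimates for alpha and N^* *)

Lemma ln_sperner_ge (R : realType) (n : nat) : (0 < n)%N ->
  ln (n%:R : R) <= (sperner n)%:R * ln 2.
Proof.
move=> n0; have [s0 sC _] := spernerP n0.
rewrite mulr_natl -lnXn // ler_ln ?posrE ?exprn_gt0 ?ltr0n //.
rewrite -natrX ler_nat; apply: leq_trans sC _.
have -> : (2 ^ sperner n = \sum_(i < (sperner n).+1) 'C(sperner n, i))%N.
  by rewrite (expnDn 1 1); apply: eq_bigr => i _; rewrite !exp1n !muln1.
have h : ((sperner n)./2 < (sperner n).+1)%N by lia.
by rewrite (bigD1 (Ordinal h)) //= leq_addr.
Qed.

Lemma exp2_le_bin_central (m : nat) : (2 ^ m <= m.+1 * 'C(m, m./2))%N.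
Proof.
rewrite (expnDn 1 1) -[in leqRHS](card_ord m.+1) -sum_nat_const.
by apply: leq_sum => i _; rewrite !exp1n !muln1 bin_le_central.
Qed.

(** For [s = sperner n], minimality bounds the central coefficient of [s - 1] by [n], whence
    [2 ^ (s - 1) <= s * n]. *)
Lemma ln_sperner_le (R : realType) (n : nat) : (0 < n)%N ->
  ((sperner n)%:R - 1) * ln 2 <= ln (n%:R : R) + ln (sperner n)%:R.
Proof.
move=> n0; have [s0 _ smin] := spernerP n0.
rewrite -lnM ?posrE ?ltr0n // -natrM.
have -> : (sperner n)%:R - 1 = (sperner n).-1%:R :> R.
  by rewrite -{1}(prednK s0) -natr1 addrK.
rewrite mulr_natl -lnXn // ler_ln ?posrE ?exprn_gt0 ?ltr0n ?muln_gt0 ?n0 //.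
rewrite -natrX ler_nat; apply: leq_trans (exp2_le_bin_central _) _.
rewrite prednK // mulnC leq_mul2r; apply/orP; right.
(* Dimension 0 is outside the range of [smin]; there the coefficient is 1. *)
have [m0|m0] := posnP (sperner n).-1; first by rewrite m0.
by rewrite leqNgt; apply/negP => /ltnW /(smin _ m0); lia.
Qed.

(** Let [N] be [Nstar n + 1], so [N - beta N n >= sperner n]. If the claim fails,
    [sperner n >= log2 n > (1 - c) N], so [beta N n <= c N] and the entropy bound makes
    ['C(N, beta N n)] smaller than [n]. *)
Lemma Nstar_lower (R : realType) (c : R) (n : nat) :
  0 < c <= 1 / 2 -> entropy c = (1 - c) * ln 2 -> (0 < n)%N ->
  ln (n%:R : R) <= (1 - c) * ln 2 * (Nstar n).+1%:R.
Proof.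
move=> c02 cE n0; have [sN _ Nmax] := NstarP n0.
have l2 : 0 < ln (2 : R) by rewrite ln_gt0 // ltr1n.
rewrite leNgt; apply/negP; set N := (Nstar n).+1 => Nn.
have sN1 : (sperner n <= N)%N by rewrite /N; lia.
have sb : (sperner n <= N - beta N n)%N.
  by rewrite leqNgt; apply/negP => /(Nmax _ sN1); rewrite ltnn.
have [b0 nC _] := betaP n0 sN1.
have s := ln_sperner_ge R n0.
have bs : (beta N n)%:R + (sperner n)%:R <= N%:R :> R.
  rewrite -natrD ler_nat; have [s0 _ _] := spernerP n0; lia.
have bc : (beta N n)%:R <= c * N%:R.
  have : (1 - c) * N%:R * ln 2 <= (sperner n)%:R * ln 2 by lra.
  by rewrite ler_pM2r //; lra.
have := ln_bin_le c02 bc; rewrite cE.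
have : ln (n%:R : R) <= ln 'C(N, beta N n)%:R.
  by rewrite ler_ln ?posrE ?ltr0n ?ler_nat //; exact: leq_trans nC.
by lra.
Qed.

(** Let [b] be the mode for parameter [c]. Either ['C(N, b) < n] and [ln_bin_ge] suffices, or
    [beta N n <= b] and [N <= sperner n + b] with [b <= (N + 1) c]. *)
Lemma Nstar_upper (R : realType) (c : R) (n : nat) :
  0 < c <= 1 / 2 -> entropy c = (1 - c) * ln 2 -> (1 < n)%N ->
  (1 - c) * ln 2 * (Nstar n)%:R
  <= ln (n%:R : R) + ln (Nstar n).+1%:R + (2 * ln 2 + (ln (1 - c) - ln c)).
Proof.
move=> c02 cE n1; have n0 := ltnW n1; have [sN bN _] := NstarP n0.
set N := Nstar n in sN bN *.
have [b0 nC bmin] := betaP n0 sN; have [s0 _ _] := spernerP n0.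
have l2 : 0 < ln (2 : R) by rewrite ln_gt0 // ltr1n.
have /andP[c0 c2] := c02.
have cc : 0 <= ln (1 - c) - ln c by rewrite subr_ge0 ler_ln ?posrE; lra.
have [b [bN' bc Cb]] := ln_bin_ge N c02; rewrite cE in Cb.
have [nb|bn] := leqP n 'C(N, b); last first.
  have : ln ('C(N, b)%:R : R) <= ln (n%:R : R).
    by rewrite ler_ln ?posrE ?ltr0n ?bin_gt0 ?ler_nat // ltnW.
  by lra.
(* ['C(N, 0) = 1 < n]. *)
have b_gt0 : (0 < b)%N.
  by case: b nb {bN' bc Cb} => //; rewrite bin0; lia.
have Nb : N%:R <= (sperner n)%:R + b%:R :> R.
  by rewrite -natrD ler_nat; have := bmin _ b_gt0 nb; lia.
have sl := ln_sperner_le R n0.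
have : ln ((sperner n)%:R : R) <= ln N.+1%:R.
  by rewrite ler_ln ?posrE ?ltr0n ?ler_nat //; lia.
(* Passing from [sperner n + 1] to the [sperner n - 1] of [ln_sperner_le] costs the [2 * ln 2]. *)
have : (1 - c) * N%:R <= (sperner n)%:R + 1 by move: bc; rewrite -natr1; lra.
by rewrite -(ler_pM2r l2); lra.
Qed.

(** * The entropy equation and its unique solution *)

(** The tangent to [ln] at [1 / eta]. It yields Gibbs' inequality and, for suitable [eta], absorbs
    [ln (Nstar n + 1)] into a linear term. *)
Lemma ln_le_linear (R : realType) (x eta : R) : 0 < x -> 0 < eta ->
  ln x <= eta * x - 1 - ln eta.
Proof.
move=> x0 e0; have ex : 0 < eta * x by rewrite mulr_gt0.
have : ln (1 + (eta * x - 1)) <= eta * x - 1 by rewrite le_ln1Dx //; lra.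
by rewrite addrC subrK lnM //; lra.
Qed.

(* Gibbs' inequality bounds [entropy x] by the cross entropy
   [- x ln y - (1 - x) ln (1 - y)]; conclude by [(1 - y) x < (1 - x) y]. *)
Lemma entropy_ratio_strict (R : realType) (x y : R) : 0 < x -> x < y -> y < 1 ->
  (1 - y) * entropy x < (1 - x) * entropy y.
Proof.
move=> x0 xy y1.
have ln_sub (u v : R) : 0 < u -> 0 < v -> u * ln v - u * ln u <= v - u.
  move=> u0 v0; have := @ln_le_linear R v u^-1 v0; rewrite invr_gt0 => /(_ u0).
  rewrite lnV // => h; have := ler_wpM2l (ltW u0) h.
  by rewrite !mulrBr mulrN !mulrA divff ?gt_eqF // mul1r mulr1; lra.
(* The right-hand sides [y - x] and [x - y] cancel in the sum, which is Gibbs' inequality. *)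
have g1 := @ln_sub x y x0 _.
have g2 := @ln_sub (1 - x) (1 - y) _ _.
have {}g1 := g1 ltac:(lra); have {}g2 := g2 ltac:(lra) ltac:(lra).
have ly : ln y < 0 by rewrite ln_lt0 //; apply/andP; split; lra.
rewrite /entropy; nra.
Qed.

(** [entropy x / (1 - x)] is strictly increasing, so it equals [ln 2] at most once. *)
Lemma entropy_eq_unique (R : realType) (x y : R) : 0 < x < 1 -> 0 < y < 1 ->
  entropy x = (1 - x) * ln 2 -> entropy y = (1 - y) * ln 2 -> x = y.
Proof.
move=> /andP[x0 x1] /andP[y0 y1] xE yE.
case: (ltgtP x y) => // [xy|yx].
- by have := entropy_ratio_strict x0 xy y1; rewrite xE yE; nra.
- by have := entropy_ratio_strict y0 yx x1; rewrite xE yE; nra.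
Qed.

Lemma continuous_entropy (R : realType) (x : R) : 0 < x < 1 ->
  {for x, continuous (@entropy R)}.
Proof.
move=> /andP[x0 x1]; rewrite /entropy.
have c1 : {for x, continuous (fun y : R => 1 - y)}.
  by apply: cvgB; [exact: cvg_cst|exact: cvg_id].
apply: cvgB; [apply: cvgN; apply: cvgM|apply: cvgM].
- exact: cvg_id.
- exact: continuous_ln.
- exact: c1.
- apply: (@continuous_comp _ _ _ (fun y : R => 1 - y) (@ln R)); first exact: c1.
  by apply: continuous_ln; rewrite subr_gt0.
Qed.

(** Intermediate value theorem. At these rational endpoints the signs reduce to [9^9 <= 2^9 7^7] and
    [5^5 17^17 2^17 <= 22^22], and they put [1 / (1 - c)] between [9/7] and [22/17]. *)
Lemma entropy_eq_exists (R : realType) : exists c : R,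
  2 / 9 <= c <= 5 / 22 /\ entropy c = (1 - c) * ln 2.
Proof.
pose f (x : R) := entropy x - (1 - x) * ln 2.
have fl : f (2 / 9) <= 0.
  have -> : f (2 / 9) = (ln (9 ^+ 9) - ln (2 ^+ 9 * 7 ^+ 7)) / 9.
    rewrite /f /entropy.
    have -> : 1 - 2 / 9 = 7 / 9 :> R by lra.
    rewrite !ln_div ?posrE // lnM ?posrE ?exprn_gt0 // !lnXn //.
    by field.
  rewrite -[leRHS](mul0r 9^-1) ler_pM2r // subr_le0 ler_ln ?posrE; lra.
have fr : 0 <= f (5 / 22).
  have -> : f (5 / 22) = (ln (22 ^+ 22) - ln (5 ^+ 5 * 17 ^+ 17 * 2 ^+ 17)) / 22.
    rewrite /f /entropy.
    have -> : 1 - 5 / 22 = 17 / 22 :> R by lra.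
    rewrite !ln_div ?posrE // 2?[ln (_ * _)]lnM ?posrE ?mulr_gt0 ?exprn_gt0 // !lnXn //.
    by field.
  rewrite -[leLHS](mul0r 22^-1) ler_pM2r // subr_ge0 ler_ln ?posrE; lra.
have [|||c] := @IVT R f (2 / 9) (5 / 22) 0; first lra.
- apply: continuous_in_subspaceT => x; rewrite inE /= in_itv /= => /andP[x1 x2].
  apply: cvgB; first by apply: continuous_entropy; apply/andP; split; lra.
  apply: cvgM; last exact: cvg_cst.
  by apply: cvgB; [exact: cvg_cst|exact: cvg_id].
- by rewrite ge_min fl /= le_max fr orbT.
rewrite in_itv /= => cI fc; exists c; split => //.
by move: fc; rewrite /f; lra.
Qed.

Lemma log2_entropy (R : realType) (x : R) : 0 < x < 1 ->
  log2 (x `^ (- x) * (1 - x) `^ (x - 1)) = 1 - x <-> entropy x = (1 - x) * ln 2.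
Proof.
move=> /andP[x0 x1]; have x1' : 0 < 1 - x by rewrite subr_gt0.
have l2 : ln (2 : R) != 0 by rewrite gt_eqF // ln_gt0 // ltr1n.
have -> : log2 (x `^ (- x) * (1 - x) `^ (x - 1)) = entropy x / ln 2.
  rewrite /log2 lnM ?posrE ?powR_gt0 // !ln_powR /entropy.
  by congr (_ / _); ring.
by split=> [<-|->]; rewrite ?mulfVK ?mulfK.
Qed.

Lemma log2_gt0 (R : realType) (n : nat) : (1 < n)%N -> 0 < log2 (n%:R : R).
Proof. by move=> n1; rewrite divr_gt0 // ln_gt0 // ltr1n. Qed.

(** * Asymptotics of the Ramsey number *)

(** The [+ 1] in the Ramsey bound matches that in [Nstar_lower], so no error term remains. *)
Lemma poset_ramsey_fork_lower (R : realType) (c : R) (n : nat) :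
  0 < c <= 1 / 2 -> entropy c = (1 - c) * ln 2 -> (0 < n)%N ->
  1 / (1 - c) * log2 (n%:R : R) <= (poset_ramsey (fork n) (fork n))%:R.
Proof.
move=> c02 cE n0; have l2 : 0 < ln (2 : R) by rewrite ln_gt0 // ltr1n.
have c1 : 0 < 1 - c by lra.
rewrite /log2 mulrA ler_pdivrMr // mulrAC mul1r ler_pdivrMr //.
apply: le_trans (Nstar_lower c02 cE n0) _.
have : (Nstar n).+1%:R <= (poset_ramsey (fork n) (fork n))%:R :> R.
  by rewrite ler_nat -addn1; case/andP: (poset_ramsey_fork_bounds n0).
by move=> h; have := ler_wpM2l (ltW (mulr_gt0 c1 l2)) h; lra.
Qed.

Lemma poset_ramsey_fork_upper (R : realType) (c e : R) :
  0 < c <= 1 / 2 -> entropy c = (1 - c) * ln 2 -> 0 < e ->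
  \forall n \near \oo,
    (poset_ramsey (fork n) (fork n))%:R <= (1 / (1 - c) + e) * log2 (n%:R : R).
Proof.
move=> c02 cE e0; have l2 : 0 < ln (2 : R) by rewrite ln_gt0 // ltr1n.
have c1 : 0 < 1 - c by lra.
set D := (1 - c) * ln 2; have D0 : 0 < D by rewrite mulr_gt0.
(* [eta] is chosen so that [1 / (D - eta) = (1 + s) / D]. *)
pose s := e * (1 - c) / 2; have s0 : 0 < s by rewrite divr_gt0 // mulr_gt0.
have s1 : 0 < 1 + s by lra.
pose eta := D * s / (1 + s); have eta0 : 0 < eta by rewrite divr_gt0 // mulr_gt0.
(* The constants of [Nstar_upper] and of the linear bound on [ln (Nstar n + 1)]. *)
pose K := 2 * ln 2 + (ln (1 - c) - ln c) + (eta - 1 - ln eta).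
(* Once [ln n >= B], all constants, including the [+ 3], cost at most [s * ln n]. *)
pose B := ((1 + s) * K + 3 * D) / s.
near=> n.
have n1 : (1 < n)%N by near: n; exact: nbhs_infty_gt.
have lB : B <= ln n%:R.
  have eB : expR B <= n%:R by near: n; exact: nbhs_infty_ger.
  by rewrite -[B]expRK ler_ln ?posrE ?expR_gt0 ?ltr0n // ltnW.
have N3 : (poset_ramsey (fork n) (fork n))%:R <= (Nstar n)%:R + 3 :> R.
  by rewrite -natrD ler_nat; case/andP: (poset_ramsey_fork_bounds (ltnW n1)).
apply: le_trans N3 _; set N := (Nstar n)%:R.
have up := Nstar_upper c02 cE n1; rewrite -/D -/N in up.
have lnN := ln_le_linear (ltr0Sn R (Nstar n)) eta0.
rewrite -natr1 -/N in lnN up.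
have {up lnN} N_le : (D - eta) * N <= ln n%:R + K by rewrite /K; lra.
have Deta : D - eta = D / (1 + s) by rewrite /eta; field; rewrite gt_eqF.
have {}N_le : D * N <= (1 + s) * (ln n%:R + K).
  by move: N_le; rewrite Deta mulrAC ler_pdivrMr // (mulrC (1 + s)).
have {}lB : (1 + s) * K + 3 * D <= s * ln n%:R.
  by move: lB; rewrite /B ler_pdivrMr // (mulrC s).
(* Here [2 * s = e * (1 - c)]. *)
have -> : (1 / (1 - c) + e) * log2 n%:R = (1 + 2 * s) * ln n%:R / D.
  by rewrite /log2 /s /D; field; rewrite !gt_eqF.
by rewrite ler_pdivlMr //; lra.
Unshelve. all: by end_near. Qed.

Theorem theorem4 (R : realType) :
  (forall n : nat, (0 < n)%N ->
     (Nstar n + 1 <= poset_ramsey (fork n) (fork n) <= Nstar n + 3)%N) /\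
  (exists c : R,
     let entropy_eq (x : R) :=
       0 < x < 1 /\ log2 (x `^ (- x) * (1 - x) `^ (x - 1)) = 1 - x in
     let d := 1 / (1 - c) in
     [/\ entropy_eq c,
         (forall c' : R, entropy_eq c' -> c' = c),
         `|d - 129 / 100| < 5 / 1000
       & exists eps : R^nat,
           eps n @[n --> \oo] --> (0 : R) /\
           (\forall n \near \oo,
              (poset_ramsey (fork n) (fork n))%:R
              = (d + eps n) * log2 (n%:R : R))]).
Proof.
split; first exact: poset_ramsey_fork_bounds.
have [c [/andP[c1 c2] cE]] := entropy_eq_exists R.
have c01 : 0 < c < 1 by apply/andP; split; lra.
have c02 : 0 < c <= 1 / 2 by apply/andP; split; lra.
exists c => entropy_eq d; split.
- by split=> //; apply/log2_entropy.
- move=> c' [c'01] /(log2_entropy c'01) c'E; exact: entropy_eq_unique c'E cE.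
- have c1' : 0 < 1 - c by lra.
  rewrite ltr_distl /d ltr_pdivlMr // ltr_pdivrMr //.
  by apply/andP; split; lra.
(* The lower bound makes this error nonnegative, so only the upper bound enters the limit; [n > 1]
   keeps [log2 n] nonzero. *)
exists (fun n => (poset_ramsey (fork n) (fork n))%:R / log2 n%:R - d); split.
  apply/cvgr0Pnorm_le => e e0; near=> n.
  have n1 : (1 < n)%N by near: n; exact: nbhs_infty_gt.
  have L0 := log2_gt0 R n1.
  rewrite ger0_norm; last first.
    by rewrite subr_ge0 ler_pdivlMr // (poset_ramsey_fork_lower c02 cE) // ltnW.
  rewrite lerBlDl ler_pdivrMr //; near: n.
  exact: poset_ramsey_fork_upper.
near=> n; have n1 : (1 < n)%N by near: n; exact: nbhs_infty_gt.
by rewrite addrC subrK divfK // gt_eqF // log2_gt0.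
Unshelve. all: by end_near. Qed.
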